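(* Let $U\subset\mathbb{R}^2=\mathbb{C}$ be open, $g:U\to\mathbb{C}$ holomorphic with $g'\neq 0$ everywhere, $c$ a nonzero real constant, and $h:U\to\mathbb{R}$ a smooth nowhere-vanishing function. Let $Y,\eta,S$ be as defined in the context, and suppose that $X=Y-\frac{2(h+c)}{S}\eta:U\to\mathbb{R}^3$ and $\eta:U\to\mathbb{R}^3$ are immersions. Then $X$ is an $H_1$-surface if and only if $\eta$ is a minimal surface.
   Context: Setting. Identify $\mathbb{R}^2=\mathbb{C}$ and $\mathbb{R}^3=\mathbb{C}\times\mathbb{R}$. Given $g$, let $T=1+|g|^2$ and let $Y:U\to\mathbb{S}^2$, $Y=\frac1T(2g,\,2-T)=\frac{1}{1+|g|^2}(2g,1-|g|^2)$. The induced metric is $L_{ij}=\langle Y_{,i},Y_{,j}\rangle=\frac{4|g'|^2}{T^2}\delta_{ij}$. Given smooth $h:U\to\mathbb{R}$, let $$\eta=\nabla_L h+hY,\qquad \nabla_L h=\frac{T^2}{4|g'|^2}\,(h_{,1}Y_{,1}+h_{,2}Y_{,2}),\qquad S=\langle\eta,\eta\rangle=|\nabla_Lh|^2+h^2 .$$ The map $X=Y-\frac{2(h+c)}{S}\eta$ is oriented by the unit normal $N=Y-\frac{2h}{S}\eta$, and $\langle X,N\rangle\ne1$ everywhere. The surface $\eta$ has unit normal $Y$. Curvatures. For an immersed surface $X$ with unit normal $N$ and $\langle X,N\rangle\neq1$, let $\Psi=\langle X,N\rangle$, $R=\frac{1-|X|^2}{2(\Psi-1)}$, let $k_1,k_2$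 be the principal curvatures (eigenvalues of $-dN$), $s_i=\frac{1+k_i}{1-k_iR}$, and $H_S=\frac12(s_1+s_2)$ (the spherical mean curvature). $X$ is an $H_1$-surface if $H_S\equiv0$. *)

(* Defs.v *)
From HB Require Import structures.
From mathcomp Require Import all_boot all_order all_algebra.
From mathcomp Require Import complex.
From mathcomp Require Import all_classical all_reals all_analysis.

Set Implicit Arguments.
Unset Strict Implicit.
Unset Printing Implicit Defensive.

Import Order.TTheory GRing.Theory Num.Theory.
Import numFieldNormedType.Exports.

Local Open Scope classical_set_scope.
Local Open Scope ring_scope.

Definition dot (R : realType) n (u v : 'rV[R]_n) : R :=
  \sum_(i < n) u 0 i * v 0 i.

Definition row3 (R : realType) (x y z : R) : 'rV[R]_3 :=
  \row_(i < 3) [:: x; y; z]`_i.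

(* The identification R^2 = C. *)
Definition toC (R : realType) (p : 'rV[R]_2) : R[i] :=
  Complex (p 0 0) (p 0 1).

(* |z|^2 as a real number: the library norm `|z| is valued in R[i]. *)
Definition sqnormC (R : realType) (z : R[i]) : R :=
  complex.Re z ^+ 2 + complex.Im z ^+ 2.

(* The partial derivative f_{,i} on R^2. *)
Definition pd (R : realType) (V : normedModType R) (i : 'I_2)
    (f : 'rV[R]_2 -> V) (p : 'rV[R]_2) : V :=
  'D_(delta_mx 0 i : 'rV[R]_2) f p.

(* C^n on U; maps are total, and only their values on the open set U matter. *)
Fixpoint Ck_on (R : realType) (V : normedModType R) (n : nat)
    (U : set 'rV[R]_2) (f : 'rV[R]_2 -> V) : Prop :=
  match n with
  | 0%N => forall p, U p -> {for p, continuous f}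
  | m.+1 => (forall p, U p -> differentiable f p) /\
            (forall i : 'I_2, Ck_on m U (pd i f))
  end.

Definition smooth_on (R : realType) (V : normedModType R)
    (U : set 'rV[R]_2) (f : 'rV[R]_2 -> V) : Prop :=
  forall n, Ck_on n U f.

(* Complex differentiability: the scalar field here is R[i], not R. *)
Definition holomorphic_on (R : realType) (U : set 'rV[R]_2)
    (g : R[i] -> R[i]) : Prop :=
  forall p, U p -> derivable (g : (R[i] : numFieldType) -> (R[i] : numFieldType)^o)
    (toC p) 1.

Definition cderive (R : realType) (g : R[i] -> R[i]) (z : R[i]) : R[i] :=
  derive1 (g : (R[i] : numFieldType) -> (R[i] : numFieldType)^o) z.

Section Surfaces.
Variable R : realType.
Implicit Types (U : set 'rV[R]_2) (X N : 'rV[R]_2 -> 'rV[R]_3).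

Definition immersion U X : Prop :=
  smooth_on U X /\ forall p, U p -> row_free ('J X p).

Definition unit_normal U X N : Prop :=
  forall p, U p -> [/\ differentiable N p, dot (N p) (N p) = 1 &
                       forall i, dot (N p) (pd i X p) = 0].

(* The matrix W of the shape operator -dN in the basis X_{,1}, X_{,2} of the
   tangent plane: the rows of 'J X p are X_{,1} and X_{,2}, those of 'J N p are
   N_{,1} and N_{,2}, and - N_{,i} = \sum_j W i j *: X_{,j}. *)
Definition shape_operator X N (p : 'rV[R]_2) : 'M[R]_2 :=
  - 'J N p *m pinvmx ('J X p).

(* k1, k2 are the eigenvalues of -dN at p, counted with multiplicity. *)
Definition principal_curvatures X N (p : 'rV[R]_2) (k1 k2 : R) : Prop :=
  char_poly (shape_operator X N p) = ('X - k1%:P) * ('X - k2%:P).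

Definition mean_curvature_is X N (p : 'rV[R]_2) (H : R) : Prop :=
  exists k1 k2, principal_curvatures X N p k1 k2 /\ H = (k1 + k2) / 2.

Definition minimal_surface U X N : Prop :=
  [/\ immersion U X, unit_normal U X N &
      forall p, U p -> mean_curvature_is X N p 0].

Definition support_fun X N (p : 'rV[R]_2) : R := dot (X p) (N p).

Definition radius_fun X N (p : 'rV[R]_2) : R :=
  (1 - dot (X p) (X p)) / (2 * (support_fun X N p - 1)).

Definition spherical_curvature X N (p : 'rV[R]_2) (k : R) : R :=
  (1 + k) / (1 - k * radius_fun X N p).

Definition spherical_mean_curvature_is X N (p : 'rV[R]_2) (H : R) : Prop :=
  exists k1 k2, principal_curvatures X N p k1 k2 /\
    H = (spherical_curvature X N p k1 + spherical_curvature X N p k2) / 2.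

Definition H1_surface U X N : Prop :=
  [/\ immersion U X, unit_normal U X N,
      forall p, U p -> support_fun X N p != 1 &
      forall p, U p -> spherical_mean_curvature_is X N p 0].

End Surfaces.

Section Representation.
Variables (R : realType) (g : R[i] -> R[i]) (h : 'rV[R]_2 -> R) (c : R).
Implicit Types p : 'rV[R]_2.

Definition Tfun p : R := 1 + sqnormC (g (toC p)).

Definition Ymap p : 'rV[R]_3 :=
  (Tfun p)^-1 *: row3 (2 * complex.Re (g (toC p))) (2 * complex.Im (g (toC p)))
                      (2 - Tfun p).

Definition gradL p : 'rV[R]_3 :=
  (Tfun p ^+ 2 / (4 * sqnormC (cderive g (toC p)))) *:
    (pd 0 h p *: pd 0 Ymap p + pd 1 h p *: pd 1 Ymap p).

Definition eta_map p : 'rV[R]_3 := gradL p + h p *: Ymap p.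

Definition Sfun p : R := dot (eta_map p) (eta_map p).

Definition Xmap p : 'rV[R]_3 :=
  Ymap p - (2 * (h p + c) / Sfun p) *: eta_map p.

Definition Nmap p : 'rV[R]_3 := Ymap p - (2 * h p / Sfun p) *: eta_map p.

End Representation.

(* Main.v *)
(* Let v |-> v Q be the reflection in the plane orthogonal to eta.  As
   <eta, Y> = h and <eta, Y_i> = h_i, the definitions of X and N give
     X_i - N_i = -(2c/S) eta_i Q   and   X_i + R N_i = -(c/h) Y_i Q,
   where R = -(1 + c/h) is the radius function of (X, N).  If W and V are the
   shape operators of (X, N) and (eta, Y), so that N_i = - W X_i and
   Y_i = - V eta_i, this reads 1 - R W = -(S/2h) V (1 + W).  Hence each
   spherical curvature (1 + k_i)/(1 - k_i R) is -(2h/S) times the inverse of a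
   principal curvature v_i of eta, and s_1 + s_2 vanishes iff v_1 + v_2 does. *)
Require Import Defs.
From HB Require Import structures.
From mathcomp Require Import all_boot all_order all_algebra.
From mathcomp Require Import complex.
From mathcomp Require Import all_classical all_reals all_analysis.
From mathcomp Require Import ring lra.

Set Implicit Arguments.
Unset Strict Implicit.
Unset Printing Implicit Defensive.

Import Order.TTheory GRing.Theory Num.Theory.
Import numFieldNormedType.Exports.
Local Open Scope classical_set_scope.
Local Open Scope ring_scope.

(** * Differential calculus for maps on the real plane *)

Section Calculus.
Variable R : realType.
Implicit Types (p v : 'rV[R]_2) (f k : 'rV[R]_2 -> R).

(** The bound is the first-order expansion of [r] at [p] with zero linear part, and the linear part
    of such an expansion is unique. *)
Lemma is_diff0_of_little (r : 'rV[R]_2 -> R^o) p :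
    (forall e, 0 < e ->
      \forall w \near (0 : 'rV[R]_2), `|r (w + p) - r p| <= e * `|w|) ->
  is_diff p r 0.
Proof.
move=> small.
have e0 : r \o shift p =
    cst (r p) + (\0 : {linear 'rV[R]_2 -> R^o}) +o_ (0 : 'rV[R]_2) id.
  apply/eqaddoP => e e0; move: (small e e0); apply: filterS => w.
  by rewrite /= !fctE /= addr0.
have c0 : continuous (\0 : {linear 'rV[R]_2 -> R^o}).
  by move=> x; apply: cst_continuous.
have d0 := diff_unique c0 e0.
split; last exact: d0.
by apply/diff_locallyP; rewrite d0; split.
Qed.

Lemma differentiable_rV n (F : 'rV[R]_2 -> 'rV[R]_n) p :
  (forall j, differentiable (fun q => F q 0 j) p) -> differentiable F p.
Proof.
move=> dF.
have -> : F = \sum_j (fun q => F q 0 j *: ('e_j : 'rV[R]_n)).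
  by apply/funext => q; rewrite fct_sumE; exact: row_sum_delta.
by apply: differentiable_sum => j; exact: differentiableZl.
Qed.

Lemma differentiable_entry n (F : 'rV[R]_2 -> 'rV[R]_n) p j :
  differentiable F p -> differentiable (fun q => F q 0 j) p.
Proof.
move=> dF.
exact: (differentiable_comp (g := fun M : 'rV[R]_n => M 0 j) dF
  (differentiable_coord _ _ _)).
Qed.

Lemma pd_entry n (F : 'rV[R]_2 -> 'rV[R]_n) p i j :
  differentiable F p -> (pd i F p) 0 j = pd i (fun q => F q 0 j) p.
Proof. by move=> dF; rewrite /pd derive_mx ?mxE//; exact: diff_derivable. Qed.

Lemma pdD (V : normedModType R) i (F G : 'rV[R]_2 -> V) p :
    differentiable F p -> differentiable G p ->
  pd i (fun q => F q + G q) p = pd i F p + pd i G p.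
Proof. by move=> dF dG; rewrite /pd deriveD //; exact: diff_derivable. Qed.

Lemma pdB (V : normedModType R) i (F G : 'rV[R]_2 -> V) p :
    differentiable F p -> differentiable G p ->
  pd i (fun q => F q - G q) p = pd i F p - pd i G p.
Proof. by move=> dF dG; rewrite /pd deriveB //; exact: diff_derivable. Qed.

Lemma pd_cst (V : normedModType R) i (a : V) p : pd i (cst a) p = 0.
Proof. exact: derive_cst. Qed.

Lemma pdM i f k p : differentiable f p -> differentiable k p ->
  pd i (fun q => f q * k q) p = pd i f p * k p + f p * pd i k p.
Proof.
move=> df dk; rewrite /pd deriveM; try exact: diff_derivable.
by rewrite addrC mulrC.
Qed.

Lemma pd_coord i j p : pd i (fun q : 'rV[R]_2 => q 0 j) p = (j == i)%:R.
Proof.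
have /= := @pd_entry _ id p i j _.
by rewrite /pd derive_id mxE eqxx => <- //; exact: differentiable_id.
Qed.

(** Subtracting the linear form [l] leaves a remainder with zero differential, so both partial
    derivatives are those of [l]. *)
Lemma is_diff_affine_approx f p (a b : R) :
    (forall e, 0 < e -> \forall w \near (0 : 'rV[R]_2),
      `|f (w + p) - f p - (a * w 0 0 + b * w 0 1)| <= e * `|w|) ->
  [/\ differentiable f p, pd 0 f p = a & pd 1 f p = b].
Proof.
move=> small.
pose l (q : 'rV[R]_2) : R := a * q 0 0 + b * q 0 1.
pose r q := f q - l q.
have dr : is_diff p r 0.
  apply: is_diff0_of_little => e /small; apply: filterS => w.
  by congr (`|_| <= _); rewrite /r /l !mxE; ring.
have dc (s : R) : differentiable (cst s : 'rV[R]_2 -> R) p by exact: differentiable_cst.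
have dj j : differentiable (fun q : 'rV[R]_2 => q 0 j) p by exact: differentiable_coord.
have dM (s : R) j : differentiable (fun q : 'rV[R]_2 => s * q 0 j) p.
  exact: (differentiableM (dc s) (dj j)).
have pM (s : R) i j : pd i (fun q : 'rV[R]_2 => s * q 0 j) p = s * (j == i)%:R.
  by rewrite (pdM i (dc s) (dj j)) pd_cst pd_coord mul0r add0r.
have dl : differentiable l p by exact: differentiableD.
have fE : f = (fun q => r q + l q) by apply/funext => q; rewrite /r subrK.
have pf i : pd i f p = a * (0 == i)%:R + b * (1 == i)%:R.
  rewrite fE (pdD i (ex_diff (is_diff_def := dr)) dl) (pdD i (dM a 0) (dM b 1)) !pM.
  by rewrite {1}/pd deriveE // diff_val add0r.
split.
- by rewrite fE; exact: differentiableD.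
- by rewrite pf /= mulr1 mulr0 addr0.
- by rewrite pf /= mulr1 mulr0 add0r.
Qed.

Lemma pd_scale n i f (F : 'rV[R]_2 -> 'rV[R]_n) p :
  differentiable f p -> differentiable F p ->
  differentiable (fun q => f q *: F q) p /\
  pd i (fun q => f q *: F q) p = pd i f p *: F p + f p *: pd i F p.
Proof.
move=> df dF.
have dfF : differentiable (fun q => f q *: F q) p.
  apply: differentiable_rV => j.
  under eq_fun do rewrite mxE.
  by apply: differentiableM => //; exact: differentiable_entry.
split=> //; apply/rowP => j; rewrite !mxE !pd_entry //.
under eq_fun do rewrite mxE.
by rewrite pdM //; exact: differentiable_entry.
Qed.

Lemma pd_dot n i (F G : 'rV[R]_2 -> 'rV[R]_n) p :
  differentiable F p -> differentiable G p ->
  differentiable (fun q => dot (F q) (G q)) p /\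
  pd i (fun q => dot (F q) (G q)) p = dot (pd i F p) (G p) + dot (F p) (pd i G p).
Proof.
move=> dF dG.
have dj j : differentiable (fun q => F q 0 j * G q 0 j) p.
  by apply: differentiableM => //; exact: differentiable_entry.
have -> : (fun q => dot (F q) (G q)) = \sum_j (fun q => F q 0 j * G q 0 j).
  by apply/funext => q; rewrite fct_sumE.
split; first exact: differentiable_sum.
rewrite /pd derive_sum => [|j]; last exact: diff_derivable.
rewrite /dot -big_split /=; apply: eq_bigr => j _.
by rewrite -/(pd i _ p) pdM ?pd_entry //; exact: differentiable_entry.
Qed.

Lemma pdV i f p : differentiable f p -> f p != 0 ->
  pd i (fun q => (f q)^-1) p = - (f p) ^- 2 * pd i f p.
Proof.
by move=> df f0; rewrite /pd deriveV //; exact: diff_derivable.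
Qed.

Lemma row_jacobian n (F : 'rV[R]_2 -> 'rV[R]_n) p i :
  differentiable F p -> row i ('J F p) = pd i F p.
Proof. by move=> dF; rewrite /pd deriveEjacobian // rowE. Qed.

(** A partial derivative depends only on the germ at [p]; this permits differentiating identities
    that are known on [U] only. *)
Lemma near_pd (V : normedModType R) (U : set 'rV[R]_2) (f k : 'rV[R]_2 -> V) p i :
  open U -> U p -> (forall q, U q -> f q = k q) -> pd i f p = pd i k p.
Proof.
move=> oU Up fk; apply: near_eq_derive.
by apply: filterS (open_nbhs_nbhs (conj oU Up)).
Qed.

End Calculus.

(** * The complex derivative as a first-order expansion with real bounds *)

Section ComplexDifferentiability.
Variable R : realType.

Lemma holomorphic_approx (g : R[i] -> R[i]) (z : R[i]) :
    derivable (g : (R[i] : numFieldType) -> (R[i] : numFieldType)^o) z 1 ->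
  forall e : R, 0 < e -> exists2 d : R, 0 < d & forall w : R[i],
    `|w| < d%:C%C -> `|g (w + z) - g z - w * cderive g z| <= e%:C%C * `|w|.
Proof.
move=> dg e e0.
have eC : 0 < e%:C%C :> R[i] by rewrite ltcR.
have : (fun h : R[i] => h^-1 *: (g (h *: 1 + z) - g z : R[i]^o))
    @ (0 : (R[i] : numFieldType))^' --> (cderive g z : R[i]^o).
  rewrite /cderive derive1E; exact: dg.
move=> /cvgrPdist_le /(_ _ eC) [d /= d0 Hd].
(* In the partial order of [R[i]] a positive element has zero imaginary part, so the radius [d] is
   real. *)
have dE : d = (complex.Re d)%:C%C.
  by case: (d) d0 => a b; rewrite ltcE /= => /andP[/eqP -> _].
exists (complex.Re d).
  by rewrite -ltcR -dE.
rewrite -dE => w wd.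
(* The limit runs over a punctured neighbourhood, so [w = 0] is handled apart. *)
have [->|w0] := eqVneq w 0.
  by rewrite add0r subrr mul0r subrr normr0 mulr0.
have := Hd w; rewrite /= sub0r normrN => /(_ wd w0).
rewrite [w *: 1]mulr1 => H.
have -> : g (w + z) - g z - w * cderive g z =
    - (w * (cderive g z - w^-1 * (g (w + z) - g z))).
  by field.
by rewrite normrN normrM mulrC ler_pM2r ?normr_gt0.
Qed.

Lemma le_Im_normc (z : R[i]) : `|complex.Im z|%:C%C <= `|z|.
Proof. by rewrite normc_def lecR -sqrtr_sqr ler_wsqrtr // lerDr sqr_ge0. Qed.

(** The norm of ['rV[R]_2] is the maximum norm and the modulus is Euclidean; the factor 2 is a crude
    bound for sqrt 2. *)
Lemma normc_toC (w : 'rV[R]_2) : `|toC w| <= (2 * `|w|)%:C%C.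
Proof.
have c i : `|w 0 i| <= `|w|.
  rewrite [leRHS]/Num.Def.normr /= mx_normrE.
  exact: (le_bigmax _ (fun ij => `|w ij.1 ij.2|) (0, i)).
rewrite normc_def lecR /=.
rewrite -[leRHS]ger0_norm ?mulr_ge0 // -sqrtr_sqr ler_wsqrtr //.
have h0 := c 0; have h1 := c 1.
rewrite -[w 0 0 ^+ 2]real_normK ?num_real // -[w 0 1 ^+ 2]real_normK ?num_real //.
have : `|w 0 0| ^+ 2 <= `|w| ^+ 2 by rewrite ler_sqr ?nnegrE.
have : `|w 0 1| ^+ 2 <= `|w| ^+ 2 by rewrite ler_sqr ?nnegrE.
have := sqr_ge0 `|w|.
nra.
Qed.

Lemma toCD (p q : 'rV[R]_2) : toC (p + q) = toC p + toC q.
Proof. by rewrite /toC !mxE. Qed.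

End ComplexDifferentiability.

(** * Cauchy-Riemann equations and the spherical map [Ymap] *)

Section Sphere.
Variables (R : realType) (g : R[i] -> R[i]).
Implicit Types (p : 'rV[R]_2).
Let u (q : 'rV[R]_2) : R := complex.Re (g (toC q)).
Let v (q : 'rV[R]_2) : R := complex.Im (g (toC q)).

(** The complex increment [toC w * d] has real part Re d w_0 - Im d w_1 and imaginary part Im d w_0
    + Re d w_1; these are the differentials of [u] and [v]. *)
Lemma cauchy_riemann p (d := cderive g (toC p)) :
    derivable (g : (R[i] : numFieldType) -> (R[i] : numFieldType)^o) (toC p) 1 ->
  [/\ differentiable u p, pd 0 u p = complex.Re d & pd 1 u p = - complex.Im d] /\
  [/\ differentiable v p, pd 0 v p = complex.Im d & pd 1 v p = complex.Re d].
Proof.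
move=> /holomorphic_approx appr.
have near_small (e : R) : 0 < e -> \forall w \near (0 : 'rV[R]_2),
    `|g (toC (w + p)) - g (toC p) - toC w * d| <= (e * `|w|)%:C%C.
  (* Halving [e], and then the radius [r], absorbs the factor 2 of [normc_toC]. *)
  move=> e0; have [|r r0 Hr] := appr (e / 2); first exact: divr_gt0.
  have r2 : 0 < 2^-1 * r by rewrite mulr_gt0 ?invr_gt0.
  have near_w : \forall w \near (0 : 'rV[R]_2), `|w| < 2^-1 * r := nbhs0_lt r2.
  apply: filterS near_w => w wr2.
  have wr : `|toC w| < r%:C%C.
    by apply: (le_lt_trans (normc_toC w)); rewrite ltcR -ltr_pdivlMl.
  have e20 : 0 <= (e / 2)%:C%C :> R[i] by rewrite lecE /= eqxx divr_ge0 ?ltW.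
  rewrite toCD (le_trans (Hr _ wr)) //.
  rewrite (le_trans (ler_wpM2l e20 (normc_toC w))) //.
  by rewrite -rmorphM /= lecR mulrA divfK.
suff [hu hv] : (forall e, 0 < e -> \forall w \near (0 : 'rV[R]_2),
      `|u (w + p) - u p - (complex.Re d * w 0 0 + - complex.Im d * w 0 1)|
        <= e * `|w|) /\
    (forall e, 0 < e -> \forall w \near (0 : 'rV[R]_2),
      `|v (w + p) - v p - (complex.Im d * w 0 0 + complex.Re d * w 0 1)|
        <= e * `|w|).
  by split; exact: is_diff_affine_approx.
split=> e /near_small; apply: filterS => w.
  move=> /(le_trans (normc_ge_Re _)); rewrite lecR; congr (`|_| <= _).
  by rewrite /u /toC; case: (g _) => ? ?; case: (g _) => ? ?; case: (d) => ? ? /=; ring.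
move=> /(le_trans (le_Im_normc _)); rewrite lecR; congr (`|_| <= _).
by rewrite /v /toC; case: (g _) => ? ?; case: (g _) => ? ?; case: (d) => ? ? /=; ring.
Qed.

Lemma Tfun_gt0 p : 0 < Tfun g p.
Proof. by rewrite /Tfun ltr_wpDr // addr_ge0 ?sqr_ge0. Qed.

Lemma dot_row3 (F : realType) (x y z x' y' z' : F) :
  dot (row3 x y z) (row3 x' y' z') = x * x' + y * y' + z * z'.
Proof. by rewrite /dot !big_ord_recr big_ord0 !mxE /= add0r. Qed.

(** Since |g|^2 = T - 1, the claim is 4 (T - 1) + (2 - T)^2 = T^2. *)
Lemma dot_Ymap p : dot (Ymap g p) (Ymap g p) = 1.
Proof.
have T0 := lt0r_neq0 (Tfun_gt0 p).
have -> : dot (Ymap g p) (Ymap g p) = (Tfun g p)^-1 ^+ 2 *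
  ((2 * u p) ^+ 2 + (2 * v p) ^+ 2 + (2 - Tfun g p) ^+ 2).
  by rewrite /dot !big_ord_recr big_ord0 !mxE /= /u /v; ring.
rewrite -[RHS](mulVf (expf_neq0 2 T0)) exprVn; congr (_ * _).
rewrite /Tfun /sqnormC -/(u p) -/(v p); ring.
Qed.

(** This is the quotient rule, with [dT] the derivative of [T]. The last coordinate of [Ymap] is 2 /
    T - 1, hence the single term there. *)
Lemma derive_Ymap p i (du := pd i u p) (dv := pd i v p)
    (dT := 2 * (u p * du + v p * dv)) (T := Tfun g p) :
    differentiable u p -> differentiable v p ->
  differentiable (Ymap g) p /\
  pd i (Ymap g) p = row3 (2 * du / T - 2 * u p * dT / T ^+ 2)
    (2 * dv / T - 2 * v p * dT / T ^+ 2) (- 2 * dT / T ^+ 2).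
Proof.
move=> hu hv.
have T0 : T != 0 := lt0r_neq0 (Tfun_gt0 p).
have hsq (f : 'rV[R]_2 -> R) :
    differentiable f p -> differentiable (fun q => f q * f q) p.
  by move=> df; exact: differentiableM.
have hn : differentiable (fun q => u q * u q + v q * v q) p.
  by apply: differentiableD; exact: hsq.
have h1 : differentiable (cst 1 : 'rV[R]_2 -> R) p by exact: differentiable_cst.
have TE : Tfun g = (fun q => 1 + (u q * u q + v q * v q)).
  by apply/funext => q; rewrite /Tfun /sqnormC !expr2.
have hT : differentiable (Tfun g) p by rewrite TE; exact: differentiableD.
have hdT : pd i (Tfun g) p = dT.
  rewrite TE (pdD i h1 hn) pd_cst (pdD i (hsq _ hu) (hsq _ hv)).
  by rewrite (pdM i hu hu) (pdM i hv hv) -/du -/dv /dT; ring.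
have hTV : differentiable (fun q => (Tfun g q)^-1) p by exact: differentiableV.
pose P (q : 'rV[R]_2) := row3 (2 * u q) (2 * v q) (2 - Tfun g q).
have hP : differentiable P p.
  apply: differentiable_rV => j.
  under eq_fun do rewrite mxE.
  case: j => -[|[|[|//]]] j3 /=.
  - by apply: differentiableM => //; exact: differentiable_cst.
  - by apply: differentiableM => //; exact: differentiable_cst.
  - by apply: differentiableB => //; exact: differentiable_cst.
have [dY ->] := pd_scale i hTV hP; split=> //.
rewrite pdV // hdT -/T.
have -> : pd i P p = row3 (2 * du) (2 * dv) (- dT).
  apply/rowP => j; rewrite pd_entry // mxE.
  under eq_fun do rewrite mxE.
  have d2 : differentiable (cst 2 : 'rV[R]_2 -> R) p by exact: differentiable_cst.
  case: j => -[|[|[|//]]] j3 /=.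
  - by rewrite (pdM i d2 hu) pd_cst mul0r add0r.
  - by rewrite (pdM i d2 hv) pd_cst mul0r add0r.
  - by rewrite (pdB i d2 hT) hdT pd_cst sub0r.
apply/rowP => j; rewrite !mxE; case: j => -[|[|[|//]]] j3 /=;
  by rewrite -?/T; field.
Qed.

End Sphere.

(** * Characteristic polynomials of 2 x 2 matrices *)

Section TwoByTwo.
Variable F : fieldType.
Implicit Types (A B : 'M[F]_2) (k p q r s : F).

Lemma mxtrace2 A : \tr A = A 0 0 + A 1 1.
Proof. by rewrite /mxtrace big_ord_recl big_ord1; congr (_ + A _ _); apply/val_inj. Qed.

Lemma det2 (R : comNzRingType) (A : 'M[R]_2) :
  \det A = A 0 0 * A 1 1 - A 0 1 * A 1 0.
Proof.
rewrite (expand_det_row _ 0) !big_ord_recl big_ord0 /cofactor !det_mx11 !mxE /=.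
rewrite expr0 expr1 mul1r addr0 mulN1r mulrN.
by congr (_ * A _ _ - A _ _ * A _ _); apply/val_inj.
Qed.

Lemma char_poly2 A : char_poly A = 'X^2 - (\tr A)%:P * 'X + (\det A)%:P.
Proof.
rewrite /char_poly det2 !mxE /= mulr1n mulr0n det2 mxtrace2.
rewrite !(polyCD, polyCN, polyCM).
ring.
Qed.

Lemma char_poly2_splitP A k1 k2 :
  char_poly A = ('X - k1%:P) * ('X - k2%:P) <->
  \tr A = k1 + k2 /\ \det A = k1 * k2.
Proof.
have -> : ('X - k1%:P) * ('X - k2%:P) = 'X^2 - (k1 + k2)%:P * 'X + (k1 * k2)%:P.
  by rewrite rmorphM rmorphD /=; ring.
rewrite char_poly2; split=> [e|[-> ->]//].
have c1 := congr1 (fun P : {poly F} => P`_1) e.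
have c0 := congr1 (fun P : {poly F} => P`_0) e.
move: c1 c0; rewrite !coefD !coefN !coefCM !coefXn !coefX !coefC /=.
rewrite !mulr1 !mulr0 !sub0r !addr0 oppr0 !add0r => c1 c0; split=> //.
exact: oppr_inj.
Qed.

Lemma det2_affine B p q :
  \det (p%:M + q *: B) = p ^+ 2 + p * q * \tr B + q ^+ 2 * \det B.
Proof. by rewrite !det2 mxtrace2 !mxE /= !(mulr1n, mulr0n); ring. Qed.

(** [A] is a Moebius transform of [B], so eigenvalues transform in the same way. Arguing with trace
    and determinant also covers a [B] that is not diagonalizable. *)
Lemma mobius_char_poly A B p q r s k1 k2 :
    A *m (p%:M + q *: B) = r%:M + s *: B -> \det (p%:M + q *: B) != 0 ->
    char_poly B = ('X - k1%:P) * ('X - k2%:P) ->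
  char_poly A = ('X - ((r + s * k1) / (p + q * k1))%:P) *
                ('X - ((r + s * k2) / (p + q * k2))%:P).
Proof.
move=> AB D0 /char_poly2_splitP[trB detB].
have Dk : \det (p%:M + q *: B) = (p + q * k1) * (p + q * k2).
  by rewrite det2_affine trB detB; ring.
move: (D0); rewrite Dk mulf_eq0 negb_or => /andP[k10 k20].
apply/char_poly2_splitP; split; last first.
  apply: (mulIf (mulf_neq0 k10 k20)).
  rewrite -{1}Dk -det_mulmx AB det2_affine trB detB.
  by field; rewrite k10 k20.
have := congr1 (fun M : 'M[F]_2 => M 0 0) AB.
have := congr1 (fun M : 'M[F]_2 => M 0 1) AB.
have := congr1 (fun M : 'M[F]_2 => M 1 0) AB.
have := congr1 (fun M : 'M[F]_2 => M 1 1) AB.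
move: Dk trB detB; rewrite !det2 !mxtrace2 !mxE !big_ord_recl !big_ord0 !mxE /=.
rewrite !(mulr1n, mulr0n) (_ : lift ord0 ord0 = 1); last exact/val_inj.
rewrite !(add0r, addr0) => Dk trB detB e11 e10 e01 e00.
apply: (mulIf (mulf_neq0 k10 k20)); rewrite -{1}Dk.
(* The trace of r + s B times the adjugate of p + q B, written in entries; it is then expressed
   through the trace and determinant of [B]. *)
transitivity ((r + s * B 0 0) * (p + q * B 1 1) - (s * B 0 1) * (q * B 1 0)
  + ((r + s * B 1 1) * (p + q * B 0 0) - (s * B 1 0) * (q * B 0 1))).
  by rewrite -e11 -e10 -e01 -e00; ring.
transitivity ((r + s * k1) * (p + q * k2) + (r + s * k2) * (p + q * k1)).
  transitivity (2 * r * p + (r * q + s * p) * (B 0 0 + B 1 1)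
     + 2 * s * q * (B 0 0 * B 1 1 - B 0 1 * B 1 0)); first by ring.
  by rewrite trB detB; ring.
by field; rewrite k10 k20.
Qed.

End TwoByTwo.

(** * Transfer of the vanishing curvature sum between [W] and [V] *)

Section Moebius.
Variable F : numFieldType.
Implicit Types (V W : 'M[F]_2) (b r : F).

(* The hypotheses make 1 + W, 1 - r W and V invertible, so that no denominator
   below vanishes and division by zero plays no role. *)
Lemma spherical_mean_curvature_eq0 V W b r :
    1%:M - r *: W = b *: (V *m (1%:M + W)) -> b != 0 -> 1 + r != 0 ->
    \det V != 0 ->
  (exists k1 k2, char_poly W = ('X - k1%:P) * ('X - k2%:P) /\
     0 = ((1 + k1) / (1 - k1 * r) + (1 + k2) / (1 - k2 * r)) / 2) <->
  (exists v1 v2, char_poly V = ('X - v1%:P) * ('X - v2%:P) /\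
     0 = (v1 + v2) / 2).
Proof.
move=> VW b0 r0 V0.
(* Adding r (1 + W) to both sides of [VW] cancels the terms in [W]. As 1 + r is nonzero, both
   factors are invertible. *)
have bVr : (r%:M + b *: V) *m (1%:M + W) = (1 + r)%:M.
  rewrite mulmxDl -scalemxAl -VW mul_scalar_mx scalerDr scalemx1 raddfD /=.
  by rewrite addrACA subrr addr0 addrC.
have det_bVr : \det (r%:M + b *: V) * \det (1%:M + W) != 0.
  by rewrite -det_mulmx bVr det_scalar expf_neq0.
move: det_bVr; rewrite mulf_eq0 negb_or => /andP[bV0 W0].
have WE : 1%:M + W = 1%:M + 1 *: W by rewrite scale1r.
split=> [[k1 [k2 [Wk s0]]]|[v1 [v2 [Vv v0]]]].
- have [trW detW] := (char_poly2_splitP _ _ _).1 Wk.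
  have k0 : (1 + k1) * (1 + k2) != 0.
    by move: W0; rewrite WE det2_affine trW detW; congr (_ != 0); ring.
  have rk0 : (1 - k1 * r) * (1 - k2 * r) != 0.
    have : \det (1%:M + (- r) *: W) != 0.
      by rewrite scaleNr VW detZ det_mulmx !mulf_neq0 ?expf_neq0.
    by rewrite det2_affine trW detW; congr (_ != 0); ring.
  move: k0 rk0; rewrite !mulf_eq0 !negb_or => /andP[k10 k20] /andP[rk10 rk20].
  have bW : b%:M + b *: W = b *: (1%:M + W) by rewrite scalerDr scalemx1.
  have VE : V *m (b%:M + b *: W) = 1%:M + (- r) *: W.
    by rewrite scaleNr VW bW scalemxAr.
  have D0 : \det (b%:M + b *: W) != 0.
    by rewrite bW detZ mulf_neq0 ?expf_neq0.
  (* By [VE], [V] is a Moebius transform of [W]; each witness is the inverse of b times a spherical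
     curvature. *)
  exists ((1 + - r * k1) / (b + b * k1)), ((1 + - r * k2) / (b + b * k2)).
  split; first exact: mobius_char_poly VE D0 Wk.
  (* [s0] with denominators cleared; the same expression is the numerator of the sum of the two
     witnesses. *)
  have : (1 + k1) * (1 - k2 * r) + (1 + k2) * (1 - k1 * r) = 0.
    rewrite -[RHS](mul0r (2 * (1 - k1 * r) * (1 - k2 * r))) s0.
    by field; rewrite rk10 rk20.
  move=> s1.
  transitivity (((1 + k1) * (1 - k2 * r) + (1 + k2) * (1 - k1 * r)) /
    (2 * b * (1 + k1) * (1 + k2))); first by rewrite s1 mul0r.
  have bk k : b + b * k = b * (1 + k) by ring.
  by rewrite !bk; field; rewrite k20 b0 k10.
- have [trV detV] := (char_poly2_splitP _ _ _).1 Vv.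
  move: V0; rewrite detV mulf_eq0 negb_or => /andP[v10 v20].
  have k0 : (r + b * v1) * (r + b * v2) != 0.
    by move: bV0; rewrite det2_affine trV detV; congr (_ != 0); ring.
  move: k0; rewrite mulf_eq0 negb_or => /andP[k10 k20].
  (* Solving [bVr] for [W]: a one-sided inverse of a square matrix is two-sided, so r + b V may be
     moved to the right of 1 + W. *)
  have WV : W *m (r%:M + b *: V) = 1%:M + (- b) *: V.
    have : ((1 + r)^-1 *: (r%:M + b *: V)) *m (1%:M + W) = 1%:M.
      by rewrite -scalemxAl bVr scale_scalar_mx mulVf.
    move=> /mulmx1C; rewrite -scalemxAr mulmxDl mul1mx.
    move=> /(congr1 (fun M => (1 + r) *: M)); rewrite scalerA divff // scale1r.
    move=> H; apply: (addrI (r%:M + b *: V)); rewrite [LHS]H.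
    by rewrite scalemx1 scaleNr addrACA subrr addr0 raddfD /= addrC.
  exists ((1 + - b * v1) / (r + b * v1)), ((1 + - b * v2) / (r + b * v2)).
  split; first exact: mobius_char_poly WV bV0 Vv.
  (* For k = (1 - b v) / (r + b v), the factor 1 + r cancels from 1 + k and 1 - k r. *)
  have s v : v != 0 -> r + b * v != 0 ->
      (1 + (1 + - b * v) / (r + b * v)) / (1 - (1 + - b * v) / (r + b * v) * r) =
      (b * v)^-1.
    move=> vn kn; have kr : r + b * v - (1 + - b * v) * r = b * v * (1 + r) by ring.
    by field; rewrite kr vn b0 kn !mulf_neq0.
  rewrite !s //; transitivity ((v1 + v2) / 2 / (b * v1 * v2)).
    by rewrite -v0 mul0r.
  by field; rewrite v10 v20 b0.
Qed.

End Moebius.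

(** * Inner products and orthogonal complements *)

Section Dot.
Variables (R : realType) (n : nat).
Implicit Types (u v w : 'rV[R]_n) (a : R).

Lemma dotC u v : dot u v = dot v u.
Proof. by apply: eq_bigr => i _; rewrite mulrC. Qed.

Lemma dotDl u v w : dot (u + v) w = dot u w + dot v w.
Proof. by rewrite /dot -big_split; apply: eq_bigr => i _; rewrite mxE mulrDl. Qed.

Lemma dotZl a u v : dot (a *: u) v = a * dot u v.
Proof. by rewrite /dot mulr_sumr; apply: eq_bigr => i _; rewrite mxE mulrA. Qed.

Lemma dotNl u v : dot (- u) v = - dot u v.
Proof. by rewrite -scaleN1r dotZl mulN1r. Qed.

Lemma dotDr u v w : dot u (v + w) = dot u v + dot u w.
Proof. by rewrite dotC dotDl !(dotC _ u). Qed.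

Lemma dotZr a u v : dot u (a *: v) = a * dot u v.
Proof. by rewrite dotC dotZl dotC. Qed.

Lemma dotNr u v : dot u (- v) = - dot u v.
Proof. by rewrite dotC dotNl dotC. Qed.

Definition dotE := (dotDl, dotDr, dotNl, dotNr, dotZl, dotZr).

Lemma mulmx_tr_dot u v : u *m v^T = (dot u v)%:M.
Proof.
apply/matrixP => i j; rewrite !mxE !ord1 eqxx mulr1n /dot.
by apply: eq_bigr => k _; rewrite mxE.
Qed.

Lemma dot_eq0 u : dot u u = 0 -> u = 0.
Proof.
move=> /eqP; rewrite psumr_eq0 => [/allP u0|i _]; last by rewrite -expr2 sqr_ge0.
apply/rowP => i; rewrite mxE; apply/eqP; rewrite -sqrf_eq0 expr2.
by apply: u0; rewrite mem_index_enum.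
Qed.

(** The rows of [A] lie in the orthogonal complement of [u] and both have rank n - 1, so they span
    it. *)
Lemma orthogonal_submx (A B : 'M[R]_(n.-1, n)) u :
  row_free A -> dot u u != 0 ->
  (forall i, dot (row i A) u = 0) -> (forall i, dot (row i B) u = 0) ->
  (B <= A)%MS.
Proof.
move=> fA u0 Au Bu.
have ortho (C : 'M[R]_(n.-1, n)) :
    (forall i, dot (row i C) u = 0) -> (C <= kermx u^T)%MS.
  move=> Cu; apply/sub_kermxP/row_matrixP => i.
  by rewrite row_mul mulmx_tr_dot Cu row0 raddf0.
have ru : \rank u^T = 1%N.
  have un0 : u != 0 by apply: contraNneq u0 => ->; rewrite -(scale0r 0) dotZl mul0r.
  by rewrite mxrank_tr rank_rV un0.
have AK : (kermx u^T <= A)%MS.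
  have /mxrank_leqif_sup := ortho _ Au.
  move=> /leqifP; case: ifP => // _; rewrite mxrank_ker ru subn1.
  by move/eqP: fA => ->; rewrite ltnn.
exact: submx_trans (ortho _ Bu) AK.
Qed.

(** The pseudo-inverse gives an exact solution because the rows of [B] lie in the row space of
    [A]. *)
Lemma weingarten (A B : 'M[R]_(n.-1, n)) u :
  row_free A -> dot u u != 0 ->
  (forall i, dot (row i A) u = 0) -> (forall i, dot (row i B) u = 0) ->
  (- B *m pinvmx A) *m A = - B.
Proof.
move=> fA u0 Au Bu; rewrite mulmxKpV // eqmx_opp.
exact: orthogonal_submx Bu.
Qed.

End Dot.

(** * Reflection along a vector, acting on rows from the right *)

Section Reflection.
Variables (R : realType) (n : nat) (eta : 'rV[R]_n).
Implicit Types (u v : 'rV[R]_n).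

Definition reflection_mx : 'M[R]_n := 1%:M - (2 / dot eta eta) *: (eta^T *m eta).

Lemma mul_reflection_mx u :
  u *m reflection_mx = u - (2 * dot u eta / dot eta eta) *: eta.
Proof.
rewrite mulmxBr mulmx1 -scalemxAr mulmxA mulmx_tr_dot mul_scalar_mx scalerA.
by congr (_ - _ *: _); rewrite mulrAC.
Qed.

Lemma dot_reflection u v : dot eta eta != 0 ->
  dot (u *m reflection_mx) (v *m reflection_mx) = dot u v.
Proof.
by move=> eta0; rewrite !mul_reflection_mx !dotE !(dotC eta); field.
Qed.

End Reflection.

(** * Unit normals and shape operators *)

Section Immersions.
Variable R : realType.

Lemma dot_pd_unit (U : set 'rV[R]_2) n (N : 'rV[R]_2 -> 'rV[R]_n) p i :
    open U -> U p -> differentiable N p -> (forall q, U q -> dot (N q) (N q) = 1) ->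
  dot (pd i N p) (N p) = 0.
Proof.
move=> oU Up dN NN; have [_] := pd_dot i dN dN.
rewrite (near_pd (k := (cst 1 : 'rV[R]_2 -> R)) i oU Up NN) pd_cst (dotC (N p)).
by move=> /esym/eqP; rewrite -mulr2n mulrn_eq0 => /eqP.
Qed.

Lemma immersion_differentiable (U : set 'rV[R]_2) (X : 'rV[R]_2 -> 'rV[R]_3) p :
  immersion U X -> U p -> differentiable X p.
Proof. by move=> [/(_ 1%N) [dX _] _] /dX. Qed.

(** Derivatives of the unit normal are tangent to the surface, so the pseudo-inverse in
    [shape_operator] does yield the matrix of -dN. *)
Lemma shape_operatorE (U : set 'rV[R]_2) (X N : 'rV[R]_2 -> 'rV[R]_3) p :
  open U -> immersion U X -> unit_normal U X N -> U p ->
  shape_operator X N p *m 'J X p = - 'J N p.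
Proof.
move=> oU iX nX Up; have dX := immersion_differentiable iX Up.
have [dN NN NX] := nX p Up.
apply: (@weingarten _ 3 _ _ (N p)) => [||i|i].
- exact: iX.2.
- by rewrite NN oner_neq0.
- by rewrite row_jacobian // dotC NX.
- by rewrite row_jacobian //; apply: (dot_pd_unit i oU Up dN) => q /nX[].
Qed.

End Immersions.

(* The rows are passed through x, y, z, w because rewriting with row_jacobian
   would make the unifier compare Jacobians by unfolding differentials. *)
Lemma shape_relation (F : fieldType) m n (A B C D : 'M[F]_(m, n)) (Q : 'M[F]_n)
    (V W : 'M[F]_m) (x y z w : 'I_m -> 'rV[F]_n) r a b :
    (forall i, row i A = x i) -> (forall i, row i B = y i) ->
    (forall i, row i C = z i) -> (forall i, row i D = w i) ->
    row_free A -> W *m A = - B -> V *m C = - D -> a != 0 ->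
    (forall i, x i = y i + a *: (z i *m Q)) ->
    (forall i, x i + r *: y i = b *: (w i *m Q)) ->
  1%:M - r *: W = - (b / a) *: (V *m (1%:M + W)).
Proof.
move=> Ax By Cz Dw fA WA VC a0 xy xy'.
have AB : A = B + a *: (C *m Q).
  apply/row_matrixP => i; have := xy i; rewrite -Ax -By -Cz -row_mul => e.
  by apply/rowP => j; have := congr1 (fun v : 'rV[F]_n => v 0 j) e; rewrite !mxE.
have AB' : A + r *: B = b *: (D *m Q).
  apply/row_matrixP => i; have := xy' i; rewrite -Ax -By -Dw -row_mul => e.
  by apply/rowP => j; have := congr1 (fun v : 'rV[F]_n => v 0 j) e; rewrite !mxE.
(* After right multiplication by [A], which can be cancelled, both sides equal b D Q. *)
apply: (row_free_inj fA) => /=.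
rewrite mulmxBl mul1mx -scalemxAl WA scalerN opprK AB' -scalemxAl -mulmxA mulmxDl.
rewrite mul1mx WA [A - B](_ : _ = a *: (C *m Q)); last by rewrite {1}AB addrC addKr.
by rewrite -scalemxAr scalerA mulNr divfK // mulmxA VC mulNmx scalerN scaleNr opprK.
Qed.

(** The Gram matrix of the rows of [D] is k times the identity, so V C D^T = - k exhibits a right
    inverse of [V]. *)
Lemma gram_unitmx (R : realType) m n (V : 'M[R]_m) (C D : 'M[R]_(m, n))
    (w : 'I_m -> 'rV[R]_n) k :
    (forall i, row i D = w i) -> V *m C = - D -> k != 0 ->
    (forall i j, dot (w i) (w j) = if i == j then k else 0) ->
  \det V != 0.
Proof.
move=> Dw VC k0 ww.
have DD : D *m D^T = k%:M.
  apply/matrixP => i j; rewrite [RHS]mxE mulrb -ww -!Dw mxE /dot.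
  by apply: eq_bigr => l _; rewrite !mxE.
have VU : V *m (- k^-1 *: (C *m D^T)) = 1%:M.
  by rewrite -scalemxAr mulmxA VC mulNmx DD scaleNr scalerN opprK scale_scalar_mx mulVf.
by have [+ _] := mulmx1_unit VU; rewrite unitmxE unitfE.
Qed.

(** * Geometry of the surfaces X and eta *)

Section Congruence.
Variables (R : realType) (U : set 'rV[R]_2) (g : R[i] -> R[i]) (c : R).
Variable h : 'rV[R]_2 -> R.
Hypotheses (openU : open U) (g_hol : holomorphic_on U g).
Hypothesis g'_neq0 : forall p, U p -> cderive g (toC p) != 0.
Hypothesis c_neq0 : c != 0.
Hypothesis h_smooth : smooth_on U (h : 'rV[R]_2 -> R^o).
Hypothesis h_neq0 : forall p, U p -> h p != 0.
Hypotheses (X_imm : immersion U (Xmap g h c)) (eta_imm : immersion U (eta_map g h)).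

Local Notation Y := (Ymap g).
Local Notation eta := (eta_map g h).
Local Notation S := (Sfun g h).
Local Notation X := (Xmap g h c).
Local Notation N := (Nmap g h).

Let metric p : R := 4 * sqnormC (cderive g (toC p)) / Tfun g p ^+ 2.

Lemma sqnormC_gt0 (z : R[i]) : z != 0 -> 0 < sqnormC z.
Proof.
case: z => a b z0; rewrite lt_neqAle addr_ge0 ?sqr_ge0 // andbT eq_sym.
apply: contraNneq z0 => /eqP; rewrite paddr_eq0 ?sqr_ge0 // !sqrf_eq0 /=.
by move=> /andP[/eqP -> /eqP ->].
Qed.

Lemma metric_gt0 p : U p -> 0 < metric p.
Proof.
by move=> Up; rewrite divr_gt0 ?mulr_gt0 ?exprn_gt0 ?Tfun_gt0 ?sqnormC_gt0 ?g'_neq0.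
Qed.

Lemma differentiable_Ymap p : U p -> differentiable Y p.
Proof.
move=> Up; have [[du _ _] [dv _ _]] := cauchy_riemann (g_hol Up).
by have [] := derive_Ymap 0 du dv.
Qed.

(** [Ymap] is the inverse stereographic projection of g, hence conformal; the Cauchy-Riemann
    equations make the mixed products cancel. *)
Lemma dot_pd_Ymap p i j : U p ->
  dot (pd i Y p) (pd j Y p) = if i == j then metric p else 0.
Proof.
move=> Up; have [[du du0 du1] [dv dv0 dv1]] := cauchy_riemann (g_hol Up).
have [_ ->] := derive_Ymap i du dv; have [_ ->] := derive_Ymap j du dv.
have T0 : 1 + sqnormC (g (toC p)) != 0 := lt0r_neq0 (Tfun_gt0 g p).
have E (k : 'I_2) : k = 0 \/ k = 1.
  by case: k => -[|[|//]] k2; [left|right]; exact/val_inj.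
rewrite dot_row3 /metric /Tfun.
by case: (E i) => ->; case: (E j) => ->; rewrite /= ?du0 ?du1 ?dv0 ?dv1;
  move: T0; rewrite /sqnormC => T0; field.
Qed.

Lemma dot_Ymap_pd p i : U p -> dot (Y p) (pd i Y p) = 0.
Proof.
move=> Up; rewrite dotC.
by apply: (dot_pd_unit i openU Up (differentiable_Ymap Up)) => q _; exact: dot_Ymap.
Qed.

Lemma gradLE p : gradL g h p =
  (metric p)^-1 *: (pd 0 h p *: pd 0 Y p + pd 1 h p *: pd 1 Y p).
Proof. by rewrite /gradL /metric invf_div. Qed.

Lemma dot_eta_Ymap p : U p -> dot (eta p) (Y p) = h p.
Proof.
move=> Up; have ortho i : dot (pd i Y p) (Y p) = 0 by rewrite dotC dot_Ymap_pd.
rewrite /eta_map gradLE; move: (dot_Ymap g p) (ortho 0) (ortho 1).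
move: (pd 0 Y p) (pd 1 Y p) (Y p) (metric p)^-1 => y0 y1 y m yy o0 o1.
by rewrite !dotE yy o0 o1; ring.
Qed.

(** The inverse factor in [gradLE] cancels the metric, and the component along Y contributes
    nothing. *)
Lemma dot_eta_pd_Ymap p i : U p -> dot (eta p) (pd i Y p) = pd i h p.
Proof.
move=> Up; have m0 := lt0r_neq0 (metric_gt0 Up).
rewrite /eta_map gradLE; move: (dot_Ymap_pd i Up).
have := dot_pd_Ymap 0 i Up; have := dot_pd_Ymap 1 i Up.
have : i = 0 \/ i = 1 by case: (i) => -[|[|//]] ?; [left|right]; exact/val_inj.
case=> ->; move: (pd 0 Y p) (pd 1 Y p) (Y p) (metric p) m0 => y0 y1 y m m0 /= e1 e0 o;
  by rewrite !dotE e1 e0 o; field.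
Qed.

Lemma differentiable_h p : U p -> differentiable h p.
Proof. by have [dh _] := h_smooth 1; exact: dh. Qed.

Lemma differentiable_eta p : U p -> differentiable eta p.
Proof. exact: immersion_differentiable. Qed.

(** Differentiate <eta, Y> = h and subtract <eta, Y_i> = h_i: thus Y is normal to eta. *)
Lemma dot_pd_eta_Ymap p i : U p -> dot (pd i eta p) (Y p) = 0.
Proof.
move=> Up; have [_] := pd_dot i (differentiable_eta Up) (differentiable_Ymap Up).
rewrite dot_eta_pd_Ymap // (near_pd (k := h) i openU Up) => [/esym/eqP|q]; last first.
  exact: dot_eta_Ymap.
by rewrite -subr_eq0 addrK => /eqP.
Qed.

Lemma Sfun_neq0 p : U p -> S p != 0.
Proof.
move=> Up; apply: contra_neq (h_neq0 Up) => /dot_eq0 eta0.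
by rewrite -(dot_eta_Ymap Up) eta0 -(scale0r 0) dotZl mul0r.
Qed.

(** One formula serves both maps: f = h gives N and f = h + c gives X. *)
Lemma pd_shift_eta (f : 'rV[R]_2 -> R) p i : U p -> differentiable f p ->
    differentiable (fun q => Y q - (2 * f q / S q) *: eta q) p /\
    pd i (fun q => Y q - (2 * f q / S q) *: eta q) p = pd i Y p -
      ((2 * pd i f p / S p - 4 * f p * dot (pd i eta p) (eta p) / S p ^+ 2) *: eta p
       + (2 * f p / S p) *: pd i eta p).
Proof.
move=> Up df; have S0 := Sfun_neq0 Up.
have de := differentiable_eta Up; have dY := differentiable_Ymap Up.
have [dS pS] := pd_dot i de de.
have dSV : differentiable (fun q => (S q)^-1) p by exact: differentiableV.
have d2 : differentiable (cst 2 : 'rV[R]_2 -> R) p by exact: differentiable_cst.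
have d2f : differentiable (fun q => 2 * f q) p by exact: differentiableM.
have dk : differentiable (fun q => 2 * f q / S q) p by exact: differentiableM.
have [dke pke] := pd_scale i dk de.
split; first exact: differentiableB.
rewrite (pdB i dY dke) pke (pdM i d2f dSV) (pdV (f := S) i dS S0) (pdM i d2 df) pd_cst.
have -> : pd i S p = dot (pd i eta p) (eta p) + dot (eta p) (pd i eta p) by exact: pS.
rewrite /cst; move: (pd i Y p) (pd i eta p) (eta p) (S p) S0 (pd i f p) (f p).
move=> y' e' e s s0 f' f0.
suff -> : (0 * f0 + 2 * f') / s + 2 * f0 * (- s ^- 2 * (dot e' e + dot e e')) =
  2 * f' / s - 4 * f0 * dot e' e / s ^+ 2 by [].
by rewrite (dotC e); field.
Qed.

Local Notation Q p := (reflection_mx (eta p)).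

Lemma differentiable_Nmap p : U p -> differentiable N p.
Proof. by move=> Up; have [] := pd_shift_eta 0 Up (differentiable_h Up). Qed.

(** In the difference the Y_i and h_i terms cancel; the factor 1 + c / h is chosen so that in the
    second combination the eta_i terms cancel. *)
Lemma pd_Xmap_Nmap p i : U p ->
  pd i X p = pd i N p + - (2 * c / S p) *: (pd i eta p *m Q p) /\
  pd i X p + - (1 + c / h p) *: pd i N p = - (c / h p) *: (pd i Y p *m Q p).
Proof.
move=> Up; have h0 := h_neq0 Up; have S0 := Sfun_neq0 Up.
have dh := differentiable_h Up.
have dhc : differentiable (fun q => h q + c) p.
  by apply: differentiableD => //; exact: differentiable_cst.
have phc : pd i (fun q => h q + c) p = pd i h p.
  rewrite /pd deriveD; [|exact: diff_derivable|exact: derivable_cst].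
  by rewrite derive_cst addr0.
have pN : pd i N p = pd i Y p -
    ((2 * pd i h p / S p - 4 * h p * dot (pd i eta p) (eta p) / S p ^+ 2) *: eta p
     + (2 * h p / S p) *: pd i eta p) := (pd_shift_eta i Up dh).2.
have pX : pd i X p = pd i Y p -
    ((2 * pd i h p / S p - 4 * (h p + c) * dot (pd i eta p) (eta p) / S p ^+ 2) *: eta p
     + (2 * (h p + c) / S p) *: pd i eta p).
  by rewrite -phc; exact: (pd_shift_eta i Up dhc).2.
have Ye : dot (pd i Y p) (eta p) = pd i h p by rewrite dotC dot_eta_pd_Ymap.
have ee : dot (eta p) (eta p) = S p by [].
(* Once <Y_i, eta> = h_i and <eta, eta> = S are substituted, both identities hold for arbitrary
   vectors. *)
rewrite pN pX !mul_reflection_mx; move: Ye ee S0 h0 => {pN pX phc dhc dh}.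
move: (pd i Y p) (pd i eta p) (eta p) (S p) (h p) (pd i h p).
move=> y' e' e s k k' -> -> s0 k0; move: (dot e' e) => d.
by split; apply/rowP => j; rewrite !mxE; field; rewrite ?k0 ?s0.
Qed.

Lemma NmapE p : U p -> N p = Y p *m Q p.
Proof. by move=> Up; rewrite mul_reflection_mx dotC dot_eta_Ymap. Qed.

Lemma unit_normal_Ymap : unit_normal U eta Y.
Proof.
move=> p Up; split=> [||i]; [exact: differentiable_Ymap|exact: dot_Ymap|].
by rewrite dotC dot_pd_eta_Ymap.
Qed.

Lemma dot_Nmap p : U p -> dot (N p) (N p) = 1.
Proof.
by move=> Up; rewrite !NmapE // dot_reflection ?dot_Ymap //; exact: Sfun_neq0.
Qed.

(** X_i is N_i plus a multiple of the reflected eta_i. N_i is orthogonal to N, and N is the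
    reflected Y, so <eta_i, Y> = 0 settles the other term. *)
Lemma unit_normal_Nmap : unit_normal U X N.
Proof.
move=> p Up; split=> [||i]; [exact: differentiable_Nmap|exact: dot_Nmap|].
have [XN _] := pd_Xmap_Nmap i Up.
have NN : dot (pd i N p) (N p) = 0.
  exact: (dot_pd_unit i openU Up (differentiable_Nmap Up) dot_Nmap).
rewrite XN dotDr (dotC _ (pd i N p)) NN add0r dotZr.
rewrite NmapE // dot_reflection; last exact: Sfun_neq0.
by rewrite dotC dot_pd_eta_Ymap // mulr0.
Qed.

Lemma support_fun_Xmap p : U p -> support_fun X N p = 1 + 2 * h p * c / S p.
Proof.
move=> Up; have S0 := Sfun_neq0 Up.
have := dot_eta_Ymap Up; have := dot_Ymap g p; have : dot (eta p) (eta p) = S p by [].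
rewrite /support_fun /Xmap /Nmap.
move: (eta p) (Y p) (S p) S0 => e y s s0 ee yy ey.
by rewrite !dotE (dotC y e) ee yy ey; field.
Qed.

Lemma radius_fun_Xmap p : U p -> radius_fun X N p = - (1 + c / h p).
Proof.
move=> Up; have S0 := Sfun_neq0 Up; have h0 := h_neq0 Up.
have := dot_eta_Ymap Up; have := dot_Ymap g p; have : dot (eta p) (eta p) = S p by [].
rewrite /radius_fun support_fun_Xmap // /Xmap.
move: (eta p) (Y p) (S p) S0 => e y s s0 ee yy ey.
rewrite !dotE (dotC y e) ee yy ey.
(* The numerator of the support function minus 1, nonzero because h and c are. *)
have hc : s + 2 * h p * c + -1 * s = 2 * h p * c by ring.
by field; rewrite hc h0 s0 !mulf_neq0.
Qed.

(** The scalar is b / a with b = - c / h and a = - 2 c / S, up to sign; it simplifies to - S / (2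
    h). *)
Lemma shape_operatorsE p : U p ->
  1%:M - radius_fun X N p *: shape_operator X N p =
  - (- (c / h p) / - (2 * c / S p)) *:
    (shape_operator eta Y p *m (1%:M + shape_operator X N p)).
Proof.
move=> Up; have S0 := Sfun_neq0 Up.
have dX := immersion_differentiable X_imm Up.
have dY := differentiable_Ymap Up; have dN := differentiable_Nmap Up.
have de := differentiable_eta Up.
rewrite radius_fun_Xmap //.
apply: (shape_relation (fun i => row_jacobian i dX) (fun i => row_jacobian i dN)
  (fun i => row_jacobian i de) (fun i => row_jacobian i dY) (X_imm.2 p Up)
  (shape_operatorE openU X_imm unit_normal_Nmap Up)
  (shape_operatorE openU eta_imm unit_normal_Ymap Up) _
  (fun i => (pd_Xmap_Nmap i Up).1) (fun i => (pd_Xmap_Nmap i Up).2)).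
by rewrite oppr_eq0 !mulf_neq0 ?invr_neq0.
Qed.

(** The Gauss map Y of eta is itself an immersion, with conformal metric. *)
Lemma det_shape_operator_eta p : U p -> \det (shape_operator eta Y p) != 0.
Proof.
move=> Up.
exact: (gram_unitmx (fun i => row_jacobian i (differentiable_Ymap Up))
  (shape_operatorE openU eta_imm unit_normal_Ymap Up) (lt0r_neq0 (metric_gt0 Up))
  (fun i j => dot_pd_Ymap i j Up)).
Qed.

End Congruence.

Theorem proposition3p6 (R : realType) (U : set 'rV[R]_2) (g : R[i] -> R[i])
    (c : R) (h : 'rV[R]_2 -> R)
    (openU : open U)
    (g_hol : holomorphic_on U g)
    (g'_neq0 : forall p, U p -> cderive g (toC p) != 0)
    (c_neq0 : c != 0)
    (h_smooth : smooth_on U (h : 'rV[R]_2 -> R^o))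
    (h_neq0 : forall p, U p -> h p != 0)
    (X_imm : immersion U (Xmap g h c))
    (eta_imm : immersion U (eta_map g h)) :
  H1_surface U (Xmap g h c) (Nmap g h) <->
  minimal_surface U (eta_map g h) (Ymap g).
Proof.
(* The equivalence is pointwise; the remaining clauses of both definitions hold unconditionally. *)
have curvatures p (Up : U p) :
    spherical_mean_curvature_is (Xmap g h c) (Nmap g h) p 0 <->
    mean_curvature_is (eta_map g h) (Ymap g) p 0.
  have h0 := h_neq0 p Up; have S0 : Sfun g h p != 0 by exact: Sfun_neq0 Up.
  apply: spherical_mean_curvature_eq0.
  - exact: (shape_operatorsE openU).
  - by rewrite oppr_eq0 !mulf_neq0 ?invr_neq0 ?oppr_eq0 ?mulf_neq0 ?invr_neq0.
  (* Here 1 + R = - c / h. *)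
  - rewrite (radius_fun_Xmap (U := U)) // opprD addrA subrr add0r.
    by rewrite oppr_eq0 mulf_neq0 ?invr_neq0.
  - exact: (det_shape_operator_eta openU).
split=> [[_ _ _ H]|[_ _ H]]; split.
- exact: eta_imm.
- exact: unit_normal_Ymap.
- exact: (fun p Up => (curvatures p Up).1 (H p Up)).
- exact: X_imm.
- exact: unit_normal_Nmap.
(* The support function differs from 1 by 2 h c / S. *)
- move=> p Up; have h0 := h_neq0 p Up; have S0 : Sfun g h p != 0 by exact: Sfun_neq0 Up.
  rewrite (support_fun_Xmap (U := U)) // -subr_eq0 addrC addKr.
  by rewrite !mulf_neq0 ?invr_neq0.
- exact: (fun p Up => (curvatures p Up).2 (H p Up)).
Qed.
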